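(* Let $\vec{x}_s,\vec{x}_f\in\mathbb{R}^d$. For $T>0$ let $\psi_T$ be the minimizer of $S_T$ over the set $\bar C_{\vec{x}_s}^{\vec{x}_f}[0,T]$ of absolutely continuous $\psi:[0,T]\to\mathbb{R}^d$ with $\psi(0)=\vec{x}_s$, $\psi(T)=\vec{x}_f$. Then $S_T[\psi_T]$, as a function of $T>0$, assumes its infimum only when $T\to+\infty$ (the infimum is not attained at any finite $T$). Moreover, $$\inf_{T>0}\ \inf_{\psi\in\bar C_{\vec{x}_s}^{\vec{x}_f}[0,T]}S_T[\psi]=\lim_{T\to+\infty}\ \inf_{\psi\in\bar C_{\vec{x}_s}^{\vec{x}_f}[0,T]}S_T[\psi]=-\infty.$$
   Context: Setting. $\varepsilon>0$ is fixed, $V\in C^7(\mathbb{R}^d)$, and $U(\vec{x})=\varepsilon\Delta V(\vec{x})-\frac12|\nabla V(\vec{x})|^2$. For $T>0$ and an absolutely continuous $\psi:[0,T]\to\mathbb{R}^d$, $S_T[\psi]=\int_0^T\big(\frac12|\dot\psi|^2-U(\psi)\big)dt$ (the Onsager–Machlup functional of the drift $-\nabla V$, up to the constant $V(\vec{x}_f)-V(\vec{x}_s)$). Standing assumptions: (A1) $V$ has a local minimizer $\vec{x}_m$ with $\nabla V(\vec{x}_m)=0$ and $\nabla^2V(\vec{x}_m)$ positive definite. (A2) $U$ attains its maximum over $\mathbb{R}^d$ and its maximum points lie in a bounded domain. (A3) For every $E\in\mathbb{R}$ the level set $\{U=E\}$ is a finite union of pairwise disjoint closed connected sets. (A4) The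 set $\Lambda$ of points $\vec{x}^\star$ with $U(\vec{x}^\star)=\max_{\mathbb{R}^d}U$ is discrete without accumulation points. (A5) $\nabla^2U(\vec{x})$ has no zero eigenvalue for each $\vec{x}\in\Lambda$. (A6) For all $\vec{x}_s,\vec{x}_f\in\mathbb{R}^d$ and $T>0$, $S_T$ has a unique minimizer $\psi_T$ among absolutely continuous $\psi$ on $[0,T]$ with $\psi(0)=\vec{x}_s$, $\psi(T)=\vec{x}_f$. (A7) For all $\vec{x}_s,\vec{x}_f$ there is $M=M(\vec{x}_s,\vec{x}_f)>0$, independent of $T$, with $\int_0^T|\dot\psi_T|\,dt\le M$ for all $T>0$. *)

(* Defs.v *)
From HB Require Import structures.
From mathcomp Require Import all_boot all_order all_algebra.
From mathcomp Require Import all_classical all_reals all_analysis.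
Set Implicit Arguments.
Unset Strict Implicit.
Unset Printing Implicit Defensive.
Import Order.TTheory GRing.Theory Num.Theory.
Import numFieldNormedType.Exports.
Local Open Scope classical_set_scope.
Local Open Scope ring_scope.

Section calculus.
Context {R : realType} {d : nat}.
Implicit Types (f : 'rV[R]_d -> R) (x v : 'rV[R]_d).

(* The library norm on 'rV[R]_d is the sup norm: it gives the topology, the
   bounded sets and the derivatives, but the functionals below need the
   Euclidean norm. *)
Definition sqnorm2 v : R := \sum_(i < d) v 0 i ^+ 2.
Definition norm2 v : R := Num.sqrt (sqnorm2 v).

Definition partial (i : 'I_d) f : 'rV[R]_d -> R :=
  fun x => 'D_(delta_mx 0 i) f x.

Fixpoint class_C (k : nat) f : Prop :=
  match k with
  | 0 => continuous f
  | k'.+1 => continuous f /\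
      forall i : 'I_d, (forall x, derivable f x (delta_mx 0 i)) /\
                       class_C k' (partial i f)
  end.

Definition grad f x : 'rV[R]_d := \row_i partial i f x.

Definition hessian f x : 'M[R]_d := \matrix_(i, j) partial i (partial j f) x.

Definition laplacian f x : R := \sum_(i < d) partial i (partial i f) x.

Definition posdefmx (A : 'M[R]_d) : Prop :=
  forall v : 'rV[R]_d, v != 0 -> 0 < (v *m A *m v^T) 0 0.

Definition local_minimizer f x : Prop := \forall y \near x, f x <= f y.

Definition argmax f : set 'rV[R]_d := [set x | forall y, f y <= f x].

End calculus.

Section paths.
Context {R : realType} {d : nat}.
Implicit Types (V : 'rV[R]_d -> R) (psi : R -> 'rV[R]_d).

(* A path on [0, T] is a function on the whole line; only its values on
   [0, T] matter. *)
Definition abs_continuous (T : R) psi : Prop :=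
  forall e : R, 0 < e -> exists2 del : R, 0 < del &
    forall (n : nat) (a b : 'I_n -> R),
      (forall i, 0 <= a i /\ a i <= b i /\ b i <= T) ->
      trivIset setT (fun i => `]a i, b i[%classic) ->
      \sum_(i < n) (b i - a i) < del ->
      \sum_(i < n) norm2 (psi (b i) - psi (a i)) < e.

Definition admissible (xs xf : 'rV[R]_d) (T : R) : set (R -> 'rV[R]_d) :=
  [set psi | [/\ abs_continuous T psi, psi 0 = xs & psi T = xf]].

Definition potential_U (eps : R) V (x : 'rV[R]_d) : R :=
  eps * laplacian V x - 2^-1 * sqnorm2 (grad V x).

(* [derive1] is total. For absolutely continuous [psi] it is the derivative
   almost everywhere. The kinetic part may be non-integrable, whereas the
   negative part of the integrand is bounded on [0, T] when U is continuous:
   the action then takes its values in ]-oo, +oo]. *)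
Definition om_action (eps : R) V (T : R) psi : \bar R :=
  (\int[lebesgue_measure]_(t in `[0%R, T])
     (2^-1 * sqnorm2 (derive1 psi t) - potential_U eps V (psi t))%:E)%E.

Definition path_length (T : R) psi : \bar R :=
  (\int[lebesgue_measure]_(t in `[0%R, T]) (norm2 (derive1 psi t))%:E)%E.

Definition is_minimizer (eps : R) V (xs xf : 'rV[R]_d) (T : R) psi : Prop :=
  admissible xs xf T psi /\
  forall phi, admissible xs xf T phi ->
    (om_action eps V T psi <= om_action eps V T phi)%E.

Definition inf_action (eps : R) V (xs xf : 'rV[R]_d) (T : R) : \bar R :=
  ereal_inf [set om_action eps V T psi | psi in admissible xs xf T].

End paths.

(* Main.v *)
(* Going from xs to x in unit time, resting there, and going from x to xf in
   the last unit of time costs at most C - T * U x with C independent of T.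
   At the minimizer xm the gradient of V vanishes and its Laplacian is positive,
   so U xm > 0 and the infimum of the action tends to -oo. It is not attained:
   the Lagrangian is bounded below by - max U, so each action exceeds -oo. *)

Require Import Defs.
From HB Require Import structures.
From mathcomp Require Import all_boot all_order all_algebra.
From mathcomp Require Import all_classical all_reals all_analysis.
From mathcomp Require Import measurable_realfun ring lra.
Import Order.TTheory GRing.Theory Num.Theory.
Import numFieldNormedType.Exports.
Local Open Scope classical_set_scope.
Local Open Scope ring_scope.

(** * Squared positive parts, a norm comparison and integral estimates *)

(** Dividing by [h] leaves an error of at most [K * |h|]. With this criterion a squared ramp can be
    differentiated without singling out its kink. *)
Lemma is_derive_quadratic {R : realType} (W : normedModType R) (f : R -> W)
    (a : R) (df : W) (K : R) :
  (forall h, `|f (h + a) - f a - h *: df| <= K * h ^+ 2) -> is_derive a 1 f df.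
Proof.
move=> fK.
have fdf : h^-1 *: (f (h + a) - f a) @[h --> 0^'] --> df.
  apply/cvgrPdist_le => e e0.
  (* Taking [h = 1] shows that [K] is nonnegative; since it may be zero, the division below is by
     [K + 1]. *)
  have K0 : 0 <= K by have := fK 1; rewrite expr1n mulr1; exact: le_trans.
  have K1 : 0 < K + 1 by rewrite ltr_wpDl.
  near=> h.
  have h0 : h != 0 by near: h; exact: nbhs_dnbhs_neq.
  have he : `|h| <= e / (K + 1).
    near: h; apply: dnbhs0_le; exact: divr_gt0.
  rewrite distrC -[X in _ - X](scalerK h0) -scalerBr normrZ normfV.
  rewrite ler_pdivrMl ?normr_gt0//.
  apply: le_trans (fK h) _.
  rewrite -(normr_id h) -real_normK ?num_real// normr_id expr2 mulrCA ler_wpM2l//.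
  rewrite (le_trans (ler_wpM2l K0 he))// mulrCA ler_piMr ?(ltW e0)//.
  by rewrite ler_pdivrMr// mul1r lerDl.
split.
  rewrite /derivable; under eq_fun do rewrite scaler1.
  by apply/cvg_ex; exists df.
rewrite /derive; under eq_fun do rewrite scaler1.
exact/cvg_lim.
Unshelve. all: by end_near. Qed.

(** If [t] and [h + t] lie on the same side of 0, the remainder is [h ^+ 2] or 0. If they lie on
    opposite sides, [|t|] and [|h + t|] are both at most [|h|], which gives the same bound across
    the kink. *)
Lemma sqr_pos_part_quadratic {R : realType} (t h : R) :
  `|Num.max 0 (h + t) ^+ 2 - Num.max 0 t ^+ 2 - h * (2 * Num.max 0 t)| <= h ^+ 2.
Proof.
rewrite ler_norml; case: (leP 0 (h + t)) => ?; case: (leP 0 t) => ?;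
  apply/andP; split; nra.
Qed.

(** The slope [2 * Num.max 0 t] is at most 2 for [t <= 1], the range of the ramp arguments on
    [[0, T]]. *)
Lemma sqr_pos_part_lipschitz {R : realType} (s t : R) : s <= 1 -> t <= 1 ->
  `|Num.max 0 t ^+ 2 - Num.max 0 s ^+ 2| <= 2 * `|t - s|.
Proof.
move=> s1 t1.
have := ler_norm (t - s); have := ler_norm (s - t); rewrite (distrC s t) => ? ?.
by rewrite ler_norml; case: (leP 0 s) => ?; case: (leP 0 t) => ?; apply/andP; split; nra.
Qed.

(** The square of the right-hand side contains every [v 0 i ^+ 2] among its nonnegative products. *)
Lemma norm2_le_sum {R : realType} {d : nat} (v : 'rV[R]_d) : norm2 v <= \sum_i `|v 0 i|.
Proof.
have s0 : 0 <= \sum_i `|v 0 i| by exact: sumr_ge0.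
rewrite -(ler_pXn2r (_ : 0 < 2)%N) ?nnegrE ?sqrtr_ge0// sqr_sqrtr; last first.
  by apply: sumr_ge0 => i _; exact: sqr_ge0.
rewrite expr2 mulr_suml; apply: ler_sum => i _.
rewrite -real_normK ?num_real// expr2 ler_wpM2l//.
by rewrite (bigD1 i)//= lerDl sumr_ge0.
Qed.

(** The bracket types are arbitrary because cutting [[0, T]] produces half-open pieces. Endpoints
    are null, so the estimate is made on the closed interval, where compactness gives
    integrability. *)
Lemma integral_itv_le_cst {R : realType} (f : R -> R) (c a b : R) (b0 b1 : bool) :
  continuous f -> a <= b -> (forall t, a <= t <= b -> f t <= c) ->
  (\int[lebesgue_measure]_(t in [set` Interval (BSide b0 a) (BSide b1 b)]) (f t)%:E
    <= (c * (b - a))%:E)%E.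
Proof.
move=> cf ab fc.
have mf : measurable_fun setT (EFin \o f).
  by apply/measurable_EFinP; exact: continuous_measurable_fun.
rewrite integral_itv_bndoo; last exact: measurable_funS mf.
rewrite -(@integral_itv_bndoo _ _ _ _ true false); last exact: measurable_funS mf.
have int_cont g : continuous g -> lebesgue_measure.-integrable `[a, b] (EFin \o g).
  move=> cg; apply: continuous_compact_integrable; first exact: segment_compact.
  exact: continuous_subspaceT.
have -> : ((c * (b - a))%:E = \int[lebesgue_measure]_(t in `[a, b]) (cst c%:E t))%E.
  rewrite integral_cst//= lebesgue_measure_itv/= lte_fin EFinM.
  by case: ltgtP ab => // -> _; rewrite subrr.
apply: le_integral => //; first exact: int_cont.
- by apply: (int_cont (cst c)) => x; exact: cvg_cst.
- by move=> x; rewrite inE/= in_itv/= lee_fin; exact: fc.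
Qed.

Lemma integral_itv_split {R : realType} (f : R -> \bar R) (a b c : R) (b0 b1 : bool) :
  measurable_fun setT f -> a < b < c ->
  (\int[lebesgue_measure]_(t in [set` Interval (BSide b0 a) (BSide b1 c)]) f t =
   \int[lebesgue_measure]_(t in [set` Interval (BSide b0 a) (BLeft b)]) f t +
   \int[lebesgue_measure]_(t in [set` Interval (BLeft b) (BSide b1 c)]) f t)%E.
Proof.
move=> mf /andP[ab bc].
rewrite (@itv_bndbnd_setU _ _ _ (BLeft b)); last 2 first.
- by rewrite leBSide; case: b0; rewrite /= ?ltW.
- by rewrite leBSide; case: b1; rewrite /= ?ltW.
rewrite integral_setU//.
  by apply: measurable_funS mf.
apply/disj_setPS => x/= [].
by rewrite !in_itv/= => /andP[_ xb] /andP[bx _]; move: xb; rewrite ltNge bx.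
Qed.

(** The integral of a nonnegative function is a supremum over the simple functions below it, and a
    larger integrand has more of them. This serves for the Lagrangian of an arbitrary path, whose
    measurability is not known. *)
Lemma ge0_le_integral_nonmeasurable d (T : measurableType d) {R : realType}
  (mu : {measure set T -> \bar R}) (D : set T) (f g : T -> \bar R) :
  (forall x, D x -> 0 <= f x)%E -> (forall x, D x -> f x <= g x)%E ->
  (\int[mu]_(x in D) f x <= \int[mu]_(x in D) g x)%E.
Proof.
move=> f0 fg.
rewrite !ge0_integralE//; last by move=> x Dx; apply: le_trans (fg _ Dx); exact: f0.
apply: ereal_sup_le => _ [h/= hf <-]; exists h => // x/=.
apply: le_trans (hf x) _; rewrite /patch; case: ifP => //; rewrite inE; exact: fg.
Qed.

(** * The path that rests at a point, its admissibility and its cost *)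

Section restpath.
Context {R : realType} {d : nat}.
Implicit Types (x y xs xf v : 'rV[R]_d) (U : 'rV[R]_d -> R).

Lemma sqnorm2N v : sqnorm2 (- v) = sqnorm2 v.
Proof. by apply: eq_bigr => i _; rewrite mxE sqrrN. Qed.

Lemma sqnorm2_0 : sqnorm2 (0 : 'rV[R]_d) = 0.
Proof. by apply: big1 => i _; rewrite mxE expr0n. Qed.

Lemma sqnorm2_ge0 v : 0 <= sqnorm2 v.
Proof. by apply: sumr_ge0 => i _; exact: sqr_ge0. Qed.

Lemma continuous_sqnorm2 : continuous (@sqnorm2 R d).
Proof.
apply: continuous_big => [|i _ v]; first exact: add_continuous.
apply: (@continuous_comp _ _ _ (fun w : 'rV[R]_d => w 0 i) (fun z : R => z ^+ 2)).
  exact: coord_continuous.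
exact: exprn_continuous.
Qed.

Lemma continuous_pos_part (f : R -> R) :
  continuous f -> continuous (fun t => Num.max 0 (f t)).
Proof.
move=> cf t; apply: (@continuous_max _ _ (cst 0) f); last exact: cf.
exact: cst_continuous.
Qed.

Lemma continuous_sqr {T : topologicalType} (f : T -> R) :
  continuous f -> continuous (fun t => f t ^+ 2).
Proof.
move=> cf t; rewrite /continuous_at expr2; under eq_fun do rewrite expr2.
by apply: cvgM; exact: cf.
Qed.

Lemma continuous_lincomb {T : topologicalType} (f g : T -> R) (a b : R) :
  continuous f -> continuous g -> continuous (fun t => a * f t + b * g t).
Proof. by move=> cf cg t; apply: cvgD; apply: cvgMl_tmp; [exact: cf|exact: cg]. Qed.

(* Squaring the ramps makes the path C^1, so that derive1, a junk value at a
   kink, is the velocity at every time. *)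
Definition rest_path x xs xf (T t : R) : 'rV[R]_d :=
  x + Num.max 0 (1 - t) ^+ 2 *: (xs - x) +
  Num.max 0 (t - (T - 1)) ^+ 2 *: (xf - x).

Definition rest_speed x xs xf (T t : R) : 'rV[R]_d :=
  (2 * Num.max 0 (t - (T - 1))) *: (xf - x) - (2 * Num.max 0 (1 - t)) *: (xs - x).

Lemma derive1_rest_path x xs xf T t :
  derive1 (rest_path x xs xf T) t = rest_speed x xs xf T t.
Proof.
rewrite derive1E.
suff : is_derive t 1 (rest_path x xs xf T) (rest_speed x xs xf T t).
  by move=> ?; exact: derive_val.
(* Each squared ramp has a remainder of at most [h ^+ 2], multiplied by the norm of its
   displacement. *)
apply: (@is_derive_quadratic _ _ _ _ _ (`|xs - x| + `|xf - x|)) => h.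
rewrite /rest_path /rest_speed.
(* The departure ramp [1 - t] decreases in time, so its increment is [- h]. *)
have := sqr_pos_part_quadratic (1 - t) (- h).
have := sqr_pos_part_quadratic (t - (T - 1)) h.
rewrite sqrrN (_ : - h + (1 - t) = 1 - (h + t)); last by ring.
rewrite (_ : h + (t - (T - 1)) = h + t - (T - 1)); last by ring.
set a1 := Num.max 0 (1 - (h + t)); set a0 := Num.max 0 (1 - t).
set b1 := Num.max 0 (h + t - (T - 1)); set b0 := Num.max 0 (t - (T - 1)).
move=> bh ah.
rewrite [X in `|X|](_ : _ = (a1 ^+ 2 - a0 ^+ 2 - - h * (2 * a0)) *: (xs - x) +
    (b1 ^+ 2 - b0 ^+ 2 - h * (2 * b0)) *: (xf - x)); last first.
  by apply/rowP => i; rewrite !mxE; ring.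
rewrite (le_trans (ler_normD _ _))// !normrZ [leRHS]mulrDl.
by rewrite lerD// mulrC ler_wpM2l.
Qed.

Let continuous_subr (a : R) : continuous (fun t : R => t - a).
Proof. by move=> t; apply: cvgB; [exact: cvg_id|exact: cvg_cst]. Qed.

Let continuous_subl (a : R) : continuous (fun t : R => a - t).
Proof. by move=> t; apply: cvgB; [exact: cvg_cst|exact: cvg_id]. Qed.

Lemma continuous_rest_path x xs xf T : continuous (rest_path x xs xf T).
Proof.
move=> t; apply: cvgD; first apply: cvgD; first exact: cvg_cst.
  apply: cvgZr_tmp; exact: (continuous_sqr _ (continuous_pos_part _ (continuous_subl 1))).
apply: cvgZr_tmp;
  exact: (continuous_sqr _ (continuous_pos_part _ (continuous_subr (T - 1)))).
Qed.

Lemma continuous_rest_speed x xs xf T : continuous (rest_speed x xs xf T).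
Proof.
move=> t; apply: cvgB; apply: cvgZr_tmp; apply: cvgMl_tmp.
  exact: (continuous_pos_part _ (continuous_subr (T - 1))).
exact: (continuous_pos_part _ (continuous_subl 1)).
Qed.

Lemma norm2_comb_le (a b : R) (v w : 'rV[R]_d) :
  norm2 (a *: v + b *: w) <= `|a| * \sum_i `|v 0 i| + `|b| * \sum_i `|w 0 i|.
Proof.
rewrite (le_trans (norm2_le_sum _))// !mulr_sumr -big_split/=.
by apply: ler_sum => i _; rewrite !mxE -!normrM ler_normD.
Qed.

Lemma lipschitz_abs_continuous (T K : R) (psi : R -> 'rV[R]_d) :
  (forall s t, 0 <= s -> s <= t -> t <= T -> norm2 (psi t - psi s) <= K * (t - s)) ->
  abs_continuous T psi.
Proof.
move=> psiK e e0.
have K1 : 0 < `|K| + 1 by rewrite ltr_wpDl.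
(* [K] has no prescribed sign; [|K| + 1] is positive and dominates it. *)
exists (e / (`|K| + 1)); first exact: divr_gt0.
move=> n a b ab _; rewrite ltr_pdivlMr// => abe.
apply: le_lt_trans abe; rewrite mulr_suml; apply: ler_sum => i _.
have [a0 [aib bT]] := ab i.
apply: le_trans (psiK _ _ a0 aib bT) _; rewrite mulrC ler_wpM2l ?subr_ge0//.
by rewrite (le_trans (ler_norm _))// lerDl.
Qed.

(** For [1 <= T] the arrival ramp vanishes at time 0 and the departure ramp at time [T], even if the
    two overlap in between. Absolute continuity follows from the Lipschitz bound on squared
    ramps. *)
Lemma rest_path_admissible x xs xf T : 1 <= T ->
  admissible xs xf T (rest_path x xs xf T).
Proof.
move=> T1; split; last 2 first.
- rewrite /rest_path subr0 sub0r opprB (max_r ler01) max_l ?subr_le0//.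
  by rewrite expr1n expr0n/= scale1r scale0r addr0 subrKC.
- rewrite /rest_path subKr (max_r ler01) max_l ?subr_le0//.
  by rewrite expr1n expr0n/= scale1r scale0r addr0 subrKC.
apply: (@lipschitz_abs_continuous _
  (2 * \sum_i `|(xs - x) 0 i| + 2 * \sum_i `|(xf - x) 0 i|)) => s t s0 st tT.
rewrite /rest_path.
set a1 := Num.max 0 (1 - t); set a0 := Num.max 0 (1 - s).
set b1 := Num.max 0 (t - (T - 1)); set b0 := Num.max 0 (s - (T - 1)).
rewrite [X in norm2 X](_ : _ =
    (a1 ^+ 2 - a0 ^+ 2) *: (xs - x) + (b1 ^+ 2 - b0 ^+ 2) *: (xf - x)); last first.
  by apply/rowP => i; rewrite !mxE; ring.
rewrite (le_trans (norm2_comb_le _ _ _ _))// [leRHS]mulrDl.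
have ts : t - s = `|t - s| by rewrite ger0_norm// subr_ge0.
apply: lerD; rewrite [leRHS]mulrAC ler_wpM2r ?sumr_ge0//.
  rewrite (le_trans (sqr_pos_part_lipschitz _ _ _ _)) ?gerBl//; first exact: le_trans st.
  by rewrite ts distrC (_ : 1 - s - (1 - t) = t - s)//; ring.
rewrite (le_trans (sqr_pos_part_lipschitz _ _ _ _))//; [lra|lra|].
by rewrite ts (_ : t - (T - 1) - (s - (T - 1)) = t - s)//; ring.
Qed.

(** The Lagrangian along one ramp between [x] and [y], in the ramp's own time [s]. It does not
    involve [T], so neither do the bounds on the cost of the ramps. *)
Definition ramp_lagrangian U x y (s : R) : R :=
  2^-1 * sqnorm2 ((2 * s) *: (y - x)) - U (x + s ^+ 2 *: (y - x)).

Lemma ramp_lagrangian_bounded U x y : continuous U ->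
  exists C, forall s, 0 <= s <= 1 -> ramp_lagrangian U x y s <= C.
Proof.
move=> cU.
have cL : continuous (ramp_lagrangian U x y).
  move=> s; apply: cvgB.
    apply: cvgMl_tmp.
    apply: (@continuous_comp _ _ _ (fun s : R => (2 * s) *: (y - x)) (@sqnorm2 R d)).
      by apply: cvgZr_tmp; apply: cvgMl_tmp; exact: cvg_id.
    exact: continuous_sqnorm2.
  apply: (@continuous_comp _ _ _ (fun s : R => x + s ^+ 2 *: (y - x)) U); last exact: cU.
  apply: cvgD; first exact: cvg_cst.
  by apply: cvgZr_tmp; exact: exprn_continuous.
have [c _ Lc] := EVT_max ler01 (continuous_subspaceT cL).
exists (ramp_lagrangian U x y c) => s s01; apply: Lc.
by rewrite in_itv.
Qed.

Lemma rest_action_le U x xs xf : continuous U ->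
  exists C, forall T, 2 < T ->
  (\int[lebesgue_measure]_(t in `[0%R, T])
     (2^-1 * sqnorm2 (derive1 (rest_path x xs xf T) t) -
      U (rest_path x xs xf T t))%:E <= (C - T * U x)%:E)%E.
Proof.
move=> cU.
have [C1 C1P] := @ramp_lagrangian_bounded U x xs cU.
have [C2 C2P] := @ramp_lagrangian_bounded U x xf cU.
(* The ramps cost at most [C1] and [C2]; the rest lasts [T - 2] and costs at most [- (T - 2) * U x],
   which leaves [2 * U x] in the constant. *)
exists (C1 + C2 + 2 * U x) => T T2.
under eq_integral do rewrite derive1_rest_path.
set f := fun t : R => 2^-1 * sqnorm2 (rest_speed x xs xf T t) - U (rest_path x xs xf T t).
have cf : continuous f.
  move=> t; apply: cvgB.
    apply: cvgMl_tmp.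
    apply: (@continuous_comp _ _ _ (rest_speed x xs xf T) (@sqnorm2 R d)).
      exact: continuous_rest_speed.
    exact: continuous_sqnorm2.
  apply: continuous_comp; [exact: continuous_rest_path|exact: cU].
have mf : measurable_fun setT (EFin \o f).
  by apply/measurable_EFinP; exact: continuous_measurable_fun.
rewrite (@integral_itv_split _ (EFin \o f) 0 1)//; last by apply/andP; split; lra.
rewrite (@integral_itv_split _ (EFin \o f) 1 (T - 1))//; last by apply/andP; split; lra.
(* Here [s = 1 - t] runs backwards from [xs] to [x]; the kinetic term does not see the sign of the
   velocity. *)
have f1 t : 0 <= t <= 1 -> f t <= C1.
  move=> /andP[t0 t1]; have := C1P (1 - t).
  rewrite /f /ramp_lagrangian /rest_speed /rest_path.
  rewrite (@max_r _ _ 0 (1 - t)) ?subr_ge0// (@max_l _ _ 0 (t - (T - 1))); last by lra.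
  rewrite mulr0 scale0r sub0r sqnorm2N expr0n/= scale0r addr0; apply.
  by apply/andP; split; lra.
have f2 t : 1 <= t <= T - 1 -> f t <= - U x.
  move=> /andP[t0 t1].
  rewrite /f /rest_speed /rest_path.
  rewrite (@max_l _ _ 0 (1 - t)) ?subr_le0// (@max_l _ _ 0 (t - (T - 1))) ?subr_le0//.
  by rewrite mulr0 !scale0r subr0 sqnorm2_0 mulr0 sub0r expr0n/= !scale0r !addr0.
have f3 t : T - 1 <= t <= T -> f t <= C2.
  move=> /andP[t0 t1]; have := C2P (t - (T - 1)).
  rewrite /f /ramp_lagrangian /rest_speed /rest_path.
  rewrite (@max_l _ _ 0 (1 - t)) ?(@max_r _ _ 0 (t - (T - 1))); [|lra|lra].
  rewrite mulr0 scale0r subr0 expr0n/= scale0r addr0; apply.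
  by apply/andP; split; lra.
have -> : C1 + C2 + 2 * U x - T * U x =
  C1 * (1 - 0) + (- U x * (T - 1 - 1) + C2 * (T - (T - 1))) by ring.
rewrite !EFinD; apply: leeD; last apply: leeD; apply: integral_itv_le_cst => //; lra.
Qed.

End restpath.

(** * Continuity and positivity of [potential_U], and finiteness of the action from below *)

Section action.
Context {R : realType} {d : nat}.
Implicit Types (V : 'rV[R]_d -> R) (psi : R -> 'rV[R]_d).

Lemma class_C_continuous k (V : 'rV[R]_d -> R) : class_C k V -> continuous V.
Proof. by case: k => [|k []]. Qed.

Lemma continuous_potential_U eps V k : class_C k.+2 V -> continuous (potential_U eps V).
Proof.
move=> [_ VC].
have partialC i : continuous (partial i V) by have [_ []] := VC i.
have laplacianC : continuous (laplacian V).
  apply: continuous_big => [|i _]; first exact: add_continuous.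
  by have [_ [_ /(_ i)[_ /class_C_continuous]]] := VC i.
have sqgradC : continuous (fun x => sqnorm2 (grad V x)).
  apply: continuous_big => [|i _ x]; first exact: add_continuous.
  under eq_fun do rewrite mxE.
  apply: (@continuous_comp _ _ _ (partial i V) (fun z : R => z ^+ 2)).
    exact: partialC.
  exact: exprn_continuous.
have -> : potential_U eps V =
    (fun x => eps * laplacian V x + (- 2^-1) * sqnorm2 (grad V x)).
  by apply/funext => x; rewrite mulNr.
exact: continuous_lincomb.
Qed.

(** Testing positive definiteness on the basis vectors makes every diagonal entry of the Hessian
    positive. The Laplacian is their sum, which is nonempty by [0 < d]. *)
Lemma potential_U_gt0 eps V x : (0 < d)%N -> 0 < eps -> grad V x = 0 ->
  posdefmx (hessian V x) -> 0 < potential_U eps V x.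
Proof.
move=> d0 e0 gV pV.
rewrite /potential_U gV sqnorm2_0 mulr0 subr0 mulr_gt0//.
have diag i : 0 < partial i (partial i V) x.
  have := pV (delta_mx 0 i); rewrite -rowE trmx_delta -colE !mxE; apply.
  apply/eqP => /rowP /(_ i); rewrite !mxE !eqxx/= => /eqP.
  by rewrite oner_eq0.
pose i0 : 'I_d := Ordinal d0.
rewrite /laplacian (bigD1 i0)//=; rewrite ltr_wpDr ?diag//.
by apply: sumr_ge0 => i _; exact/ltW/diag.
Qed.

(** The kinetic term is nonnegative, so the negative part of the Lagrangian is at most [|M|] and has
    a finite integral over [[0, T]]. The positive part may integrate to [+oo], which does no
    harm. *)
Lemma om_action_gtNy eps V (T M : R) psi : (forall x, potential_U eps V x <= M) ->
  (-oo < om_action eps V T psi)%E.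
Proof.
move=> UM; rewrite /om_action; set f := (X in integral _ _ X); rewrite integralE.
have fN : (\int[lebesgue_measure]_(t in `[0%R, T]) (f^\- t) < +oo)%E.
  apply: (@le_lt_trans _ _ (\int[lebesgue_measure]_(t in `[0%R, T]) cst `|M|%:E t)%E).
    apply: ge0_le_integral_nonmeasurable => t _; first exact: funeneg_ge0.
    rewrite funenegE ge_max /f/= !lee_fin normr_ge0 andbT.
    have := UM (psi t); have := ler_norm M; have := sqnorm2_ge0 (derive1 psi t); lra.
  (* The case split separates [0 < T] from the null interval, where the product is 0. *)
  rewrite integral_cst//= lebesgue_measure_itv/=; case: ifP => _; rewrite ?mule0//.
  by rewrite -EFinB -EFinM ltry.
have f0 : (0 <= \int[lebesgue_measure]_(t in `[0%R, T]) f^\+ t)%E.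
  by apply: integral_ge0 => t _; exact: funepos_ge0.
apply: (@lt_le_trans _ _ (- \int[lebesgue_measure]_(t in `[0%R, T]) f^\- t)%E).
  by rewrite lteNr.
by rewrite leeDr.
Qed.

End action.

Theorem proposition3p7 (R : realType) (d : nat) (d_gt0 : (0 < d)%N)
  (eps : R) (eps_gt0 : 0 < eps)
  (V : 'rV[R]_d -> R) (V_C7 : class_C 7 V)
  (A1 : exists xm, [/\ local_minimizer V xm, grad V xm = 0 &
                       posdefmx (hessian V xm)])
  (A2 : argmax (potential_U eps V) !=set0 /\
        bounded_set (argmax (potential_U eps V)))
  (A3 : forall E : R, exists (n : nat) (F : 'I_n -> set 'rV[R]_d),
        [/\ forall i, closed (F i), forall i, connected (F i),
            trivIset setT F &
            [set x | potential_U eps V x = E] = \bigcup_i F i])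
  (A4 : (forall x, argmax (potential_U eps V) x ->
                   isolated (argmax (potential_U eps V)) x) /\
        limit_point (argmax (potential_U eps V)) = set0)
  (A5 : forall x, argmax (potential_U eps V) x ->
        ~~ eigenvalue (hessian (potential_U eps V) x) 0)
  (A6 : forall (xs xf : 'rV[R]_d) (T : R), 0 < T ->
        exists psi, is_minimizer eps V xs xf T psi /\
          forall phi, is_minimizer eps V xs xf T phi ->
            forall t, 0 <= t <= T -> phi t = psi t)
  (A7 : forall xs xf : 'rV[R]_d, exists M : R, 0 < M /\
        forall (T : R) (psi : R -> 'rV[R]_d), 0 < T ->
          is_minimizer eps V xs xf T psi -> (path_length T psi <= M%:E)%E)
  (xs xf : 'rV[R]_d) (psi : R -> R -> 'rV[R]_d)
  (psi_min : forall T : R, 0 < T -> is_minimizer eps V xs xf T (psi T)) :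
  (let m := ereal_inf [set om_action eps V T (psi T) | T in [set T | 0 < T]] in
   ~ (exists T : R, 0 < T /\ om_action eps V T (psi T) = m) /\
   om_action eps V T (psi T) @[T --> +oo] --> m) /\
  [/\ cvg (inf_action eps V xs xf T @[T --> +oo]),
      ereal_inf [set inf_action eps V xs xf T | T in [set T | 0 < T]] =
        lim (inf_action eps V xs xf T @[T --> +oo]) &
      lim (inf_action eps V xs xf T @[T --> +oo]) = -oo%E].
Proof.
have [xm [_ gradVxm posVxm]] := A1.
have [[xM UxM] _] := A2.
have Uxm := @potential_U_gt0 _ _ _ _ _ d_gt0 eps_gt0 gradVxm posVxm.
have cU : continuous (potential_U eps V) by exact: (@continuous_potential_U _ _ _ _ 5).
(* [psi T] realises the infimum at time [T], so both halves of the conclusion concern the same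
   function of [T]. *)
have infE T : 0 < T -> inf_action eps V xs xf T = om_action eps V T (psi T).
  move=> /psi_min[adm le_psi]; apply/eqP; rewrite eq_le; apply/andP; split.
    by apply: ereal_inf_lbound; exists (psi T).
  by apply: le_ereal_inf_tmp => _ [phi /le_psi + <-].
have inf_cvg : inf_action eps V xs xf T @[T --> +oo] --> -oo%E.
  have [C CP] := @rest_action_le _ _ (potential_U eps V) xm xs xf cU.
  apply/cvgeNyPle => A; near=> T.
  have T2 : 2 < T by near: T; exact: nbhs_pinfty_gt.
  (* This threshold is [C - T * U xm <= A] solved for [T], by positivity of [U] at [xm]. *)
  have TA : (C - A) / potential_U eps V xm <= T.
    by near: T; apply: nbhs_pinfty_ge; exact: num_real.
  apply: (@le_trans _ _ (C - T * potential_U eps V xm)%:E).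
    apply: ge_ereal_inf; exists (om_action eps V T (rest_path xm xs xf T)).
      by exists (rest_path xm xs xf T) => //; apply: rest_path_admissible; lra.
    exact: CP.
  rewrite lee_fin lerBlDr addrC -lerBlDr -ler_pdivrMr//.
have psi_cvg : om_action eps V T (psi T) @[T --> +oo] --> -oo%E.
  apply: cvg_trans inf_cvg; apply: near_eq_cvg; near=> T.
  by apply: infE; near: T; exact: nbhs_pinfty_gt.
(* The infimum is below [f T] for every [T > 0], hence below the limit of [f] at infinity. *)
have ereal_infNy (f : R -> \bar R) : f T @[T --> +oo] --> -oo%E ->
    ereal_inf [set f T | T in [set T | 0 < T]] = -oo%E.
  move=> fNy; apply/eqP; rewrite -leeNy_eq; apply: (cvge_to_ge fNy).
  apply: filterS (nbhs_pinfty_gt (num_real 0)) => T T0.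
  by apply: ereal_inf_lbound; exists T.
rewrite /= !ereal_infNy// (cvg_lim (@ereal_hausdorff R) inf_cvg).
split; last by split=> //; exact: cvgP inf_cvg.
(* A time attaining the infimum would have action [-oo], against the lower bound obtained from
   [U <= U xM]. *)
split=> //; move=> [T [_ TNy]]; have := @om_action_gtNy _ _ eps V T _ (psi T) UxM.
by rewrite TNy.
Unshelve. all: by end_near. Qed.
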